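(* Let $\mathbb{X}$ be a strictly convex real Banach space, let $\mathbf u\in\mathbb X^*$ with $\|\mathbf u\|_{\mathbb X^*}<1$, and let $\mathbf x_1,\dots,\mathbf x_k\in\mathbb X$. The geometric quantile of $\mathbf x_1,\dots,\mathbf x_k$ with parameter $\mathbf u$, if it exists, is unique if one of the following conditions holds: (i) $\mathbf x_1,\dots,\mathbf x_k$ do not lie on a straight line; (ii) $\mathbf x_1,\dots,\mathbf x_k$ lie on a straight line and $\alpha\in(0,1)\setminus\{\frac1k,\frac2k,\dots,\frac{k-1}k\}$.
   Context: A geometric quantile of $\mathbf x_1,\dots,\mathbf x_k$ with parameter $\mathbf u$ is an element of $\arg\min_{\mathbf y\in\mathbb X}\sum_{i=1}^k\|\mathbf x_i-\mathbf y\|_{\mathbb X}+\langle\mathbf u,\mathbf x_i-\mathbf y\rangle$, where $\langle\cdot,\cdot\rangle$ is the pairing of $\mathbb X^*$ and $\mathbb X$. The parameter $\alpha$ in (ii): when $\mathbf x_1,\dots,\mathbf x_k$ lie on a straight line, by translating all the data one may take the line to be a one-dimensional subspace $W$ of $\mathbb X$. Let $W^\perp=\{\mathbf v\in\mathbb X^*:\langle\mathbf v,\mathbf s\rangle=0\ \forall\mathbf s\in W\}$ and let $\mathbb X=W\oplus Y$ with $Y$ the kernel of a norm-1 projection onto $W$. Then $\mathbf u=u\mathbf e+\mathbf v$ with $\mathbf e\in Y^\perp$, $\|\mathbf e\|_{\mathbb X^*}=1$, $u\in(-1,1)$ and $\mathbf v\in W^\perp$, and $\alpha:=(u+1)/2$.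 (Equivalently, $u=\langle\mathbf u,\mathbf h\rangle$ for the unit vector $\mathbf h\in W$ with $\langle\mathbf e,\mathbf h\rangle=1$; the opposite choice of sign of $\mathbf e$ replaces $\alpha$ by $1-\alpha$.) *)

(* Defs.v *)
From HB Require Import structures.
From mathcomp Require Import all_boot all_order all_algebra.
From mathcomp Require Import all_classical all_reals all_analysis.
Set Implicit Arguments.
Unset Strict Implicit.
Unset Printing Implicit Defensive.
Import Order.TTheory GRing.Theory Num.Theory.
Import numFieldNormedType.Exports.
Local Open Scope classical_set_scope.
Local Open Scope ring_scope.

Definition strictly_convex (R : realType) (X : normedModType R) : Prop :=
  forall x y : X, `|x| = 1 -> `|y| = 1 -> x <> y -> `|x + y| < 2.

(* [sup] is 0 on unbounded sets, so this is the operator norm only for a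
   continuous linear [f]; every use below comes with continuity. An element of
   the dual space is a linear [f : X -> R^o] with [continuous f]. *)
Definition opnorm (R : realType) (V W : normedModType R) (f : V -> W) : R :=
  sup [set `|f x| | x in [set x : V | `|x| <= 1]].

Definition quantile_objective (R : realType) (X : normedModType R) (k : nat)
    (x : 'I_k -> X) (u : X -> R^o) (y : X) : R :=
  \sum_(i < k) (`|x i - y| + u (x i - y)).

Definition geometric_quantile (R : realType) (X : normedModType R) (k : nat)
    (x : 'I_k -> X) (u : X -> R^o) (y : X) : Prop :=
  forall z : X, quantile_objective x u y <= quantile_objective x u z.

Definition one_dimensional (R : realType) (X : normedModType R)
    (W : set X) : Prop :=
  exists2 d : X, d <> 0 & W = range (fun t : R => t *: d).

(* The straight lines are the translates p + W of one-dimensional W. *)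
Definition on_translate (R : realType) (X : normedModType R) (k : nat)
    (x : 'I_k -> X) (p : X) (W : set X) : Prop :=
  forall i, W (x i - p).

Definition on_straight_line (R : realType) (X : normedModType R) (k : nat)
    (x : 'I_k -> X) : Prop :=
  exists (p : X) (W : set X), one_dimensional W /\ on_translate x p W.

Definition annihilator (R : realType) (X : normedModType R) (A : set X)
    (f : {linear X -> R^o}) : Prop :=
  continuous f /\ forall s, A s -> f s = 0.

Definition norm1_projection (R : realType) (X : normedModType R) (W : set X)
    (P : {linear X -> X}) : Prop :=
  [/\ continuous P, P \o P =1 P, range P = W & opnorm P = 1].

(* The kernel [Y] of [P] is the chosen complement of [W]. Replacing [e] by
   [- e] replaces [alpha] by [1 - alpha], so this is a relation, not a
   function of [u] and [W]. *)
Definition quantile_parameter (R : realType) (X : normedModType R)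
    (u : {linear X -> R^o}) (W : set X) (alpha : R) : Prop :=
  exists (P : {linear X -> X}) (e v : {linear X -> R^o}) (s : R),
    let Y := [set z | P z = 0] in
    [/\ norm1_projection W P,
        annihilator Y e /\ opnorm e = 1,
        annihilator W v,
        (forall z, u z = s * e z + v z) /\ -1 < s < 1
      & alpha = (s + 1) / 2].

(* Main.v *)
Require Import Defs.
From HB Require Import structures.
From mathcomp Require Import all_boot all_order all_algebra.
From mathcomp Require Import all_classical all_reals all_analysis.
From mathcomp Require Import ring lra.
Import Order.TTheory GRing.Theory Num.Theory.
Import numFieldNormedType.Exports.
Local Open Scope classical_set_scope.
Local Open Scope ring_scope.

(** Suppose that two distinct points [y] and [z] both minimize the objective.
    The linear part of the objective is affine, so comparison with the midpoint
    of [y] and [z] forces equality in every triangle inequality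
    [|(x i - y) + (x i - z)| <= |x i - y| + |x i - z|]
    ([quantiles_norm_eq]). In a strictly convex space equality means that
    [x i - y] and [x i - z] lie on a common ray from the origin
    ([strictly_convex_ray]); hence [x i] lies on the line through [y] and [z],
    outside the open segment between them ([ray_difference]). This already
    excludes data that are not collinear.

    Each data point is thus beyond [z] or beyond [y], and
    [|x i - y| - |x i - z|] is [|z - y|] or [- |z - y|] accordingly. If [A] of
    the [k] points are beyond [z], equality of the two objective values reads
    [k * u (z - y) = (k - 2 A) * |z - y|] ([quantiles_balance]). For [A = 0] and
    [A = k] this contradicts [opnorm u < 1]. Otherwise there are data on both
    sides, so the direction [z - y] belongs to the given one-dimensional space
    [W]. On [W] the functional [u] takes the values [+- (2 alpha - 1) |h|]
    ([quantile_parameter_on_line]), whatever admissible decomposition defines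
    [alpha]. So [alpha] is [A / k] or [(k - A) / k], which is one of the
    excluded fractions. *)

(** * Operator norms *)

(** Continuity makes the set of values bounded, so that its [sup] is not the
    default one. *)
Lemma opnorm_ge (R : realType) (V W : normedModType R) (f : {linear V -> W})
    (x : V) : continuous f -> `|f x| <= opnorm f * `|x|.
Proof.
move=> cf; have [->|x0] := eqVneq x 0; first by rewrite linear0 !normr0 mulr0.
have nx : 0 < `|x| by rewrite normr_gt0.
have /linear_boundedP := continuous_linear_bounded 0 (cf 0).
move=> /pinfty_ex_gt0 [M M0 fM].
have bd : has_ubound [set `|f v| | v in [set v : V | `|v| <= 1]].
  exists M => _ [v /= v1 <-]; apply: le_trans (fM v) _.
  by rewrite ler_piMr // ltW.
rewrite -ler_pdivrMr //; apply: (ub_le_sup bd).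
exists (`|x|^-1 *: x) => /=; first by rewrite normrZV // unitfE gt_eqF.
by rewrite linearZ normrZ gtr0_norm ?invr_gt0 // mulrC.
Qed.

Lemma opnorm_le (R : realType) (V W : normedModType R) (f : {linear V -> W})
    (c : R) : 0 <= c -> (forall x, `|f x| <= c * `|x|) -> opnorm f <= c.
Proof.
move=> c0 fc; apply: ge_sup.
  by exists `|f 0|; exists 0 => //=; rewrite normr0.
by move=> _ [v /= v1 <-]; apply: le_trans (fc v) _; rewrite ler_piMr.
Qed.

(** * The equality case of the triangle inequality *)

(** For [`|a| <= `|b|], write [a + b] as [`|a|] times the sum of the two
    directions plus [(`|b| - `|a|)] times the direction of [b]: distinct
    directions would make its norm smaller than [2 `|a| + (`|b| - `|a|)]. *)
Lemma strictly_convex_ray (R : realType) (X : normedModType R) (a b : X) :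
  strictly_convex X -> `|a + b| = `|a| + `|b| -> `|b| *: a = `|a| *: b.
Proof.
move=> hX; wlog le_ab : a b / `|a| <= `|b|.
  move=> H; have [ab| /ltW ba] := leP `|a| `|b|; first exact: H.
  by rewrite addrC [RHS]addrC => /(H _ _ ba).
have [->|a0] := eqVneq a 0; first by rewrite normr0 scale0r scaler0.
move=> abE.
have na : 0 < `|a| by rewrite normr_gt0.
have nb : 0 < `|b| by apply: lt_le_trans le_ab.
set a1 := `|a|^-1 *: a; set b1 := `|b|^-1 *: b.
have aE : a = `|a| *: a1 by rewrite scalerA divff ?scale1r // gt_eqF.
have bE : b = `|b| *: b1 by rewrite scalerA divff ?scale1r // gt_eqF.
have na1 : `|a1| = 1 by rewrite normrZV // unitfE gt_eqF.
have nb1 : `|b1| = 1 by rewrite normrZV // unitfE gt_eqF.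
have [ab1|/eqP ab1] := eqVneq a1 b1.
  by rewrite {1}aE {2}bE ab1 [LHS]scalerA [RHS]scalerA mulrC.
have lt2 := hX _ _ na1 nb1 ab1.
have abD : a + b = `|a| *: (a1 + b1) + (`|b| - `|a|) *: b1.
  by rewrite scalerDr scalerBl -addrA subrKC -aE -bE.
have : `|a + b| < `|a| + `|b|.
  rewrite abD (le_lt_trans (ler_normD _ _)) // 2!normrZ nb1 mulr1 normr_id.
  rewrite ger0_norm ?subr_ge0 //.
  have : `|a| * `|a1 + b1| < `|a| * 2 by rewrite ltr_pM2l.
  lra.
by rewrite abE ltxx.
Qed.

(** With [a = x - y] and [b = x - z], so that [a - b = z - y]: the point [x]
    lies on the line through [y] and [z], beyond [z] if it is closer to [z] and
    beyond [y] otherwise. *)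
Lemma ray_difference (R : realType) (X : normedModType R) (a b : X) :
  `|b| *: a = `|a| *: b -> a != b ->
  (exists t, a = t *: (a - b)) /\
  `|a| - `|b| = if `|b| < `|a| then `|a - b| else - `|a - b|.
Proof.
move=> ray ab; set d := a - b.
have bE : b = a - d by rewrite /d opprB addrC subrK.
have scaled : (`|a| - `|b|) *: a = `|a| *: d.
  by rewrite scalerBl ray /d scalerBr.
have neq : `|a| - `|b| != 0.
  apply/eqP => e; move/eqP: scaled; rewrite e scale0r eq_sym scaler_eq0.
  rewrite normr_eq0 subr_eq0 (negbTE ab) orbF => /eqP a0.
  move: e; rewrite a0 normr0 sub0r => /eqP.
  rewrite oppr_eq0 normr_eq0 => /eqP b0.
  by rewrite a0 b0 eqxx in ab.
set t := `|a| / (`|a| - `|b|).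
have aE : a = t *: d.
  by rewrite /t mulrC -scalerA -scaled scalerA mulVf ?scale1r.
have bE' : b = (t - 1) *: d by rewrite {1}bE {1}aE scalerBl scale1r.
split; first by exists t.
have tE : t * (`|a| - `|b|) = `|a| by rewrite /t mulfVK.
have naE : `|a| = `|t| * `|d| by rewrite {1}aE normrZ.
have nbE : `|b| = `|t - 1| * `|d| by rewrite {1}bE' normrZ.
case: ltP => [lt_ba|le_ab].
  have t1 : 1 <= t.
    by rewrite /t ler_pdivlMr ?subr_gt0 // mul1r gerBl.
  rewrite naE nbE (ger0_norm (le_trans ler01 t1)) ger0_norm ?subr_ge0 //.
  ring.
have t0 : t <= 0.
  by rewrite /t mulr_ge0_le0 // invr_le0 subr_le0.
have t10 : t - 1 <= 0 by rewrite subr_le0 (le_trans t0).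
rewrite naE nbE (ler0_norm t0) (ler0_norm t10).
ring.
Qed.

(** * Two quantiles of the same data *)

(** The objective is a sum of convex terms whose linear parts cancel in the
    comparison with the midpoint, so optimality at [y] and [z] leaves no room
    for a strict triangle inequality. *)
Lemma quantiles_norm_eq (R : realType) (X : normedModType R) (k : nat)
    (x : 'I_k -> X) (u : {linear X -> R^o}) (y z : X) :
  geometric_quantile x u y -> geometric_quantile x u z ->
  forall i, `|(x i - y) + (x i - z)| = `|x i - y| + `|x i - z|.
Proof.
move=> qy qz.
set m := 2^-1 *: (y + z).
have mid i : (x i - y) + (x i - z) = 2 *: (x i - m).
  rewrite scalerBr scalerA divff ?pnatr_eq0 // scale1r scaler_nat mulr2n.
  by rewrite opprD addrACA.
have term i : `|x i - y| + `|x i - z| - `|(x i - y) + (x i - z)| =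
    (`|x i - y| + u (x i - y)) + (`|x i - z| + u (x i - z))
    - 2 * (`|x i - m| + u (x i - m)).
  have uE : u (x i - y) + u (x i - z) = 2 * u (x i - m).
    by rewrite -linearD mid linearZ.
  rewrite mid normrZ ger0_norm ?ler0n //.
  move: uE; set p : R := u (x i - y); set q : R := u (x i - z).
  set r : R := u (x i - m); lra.
have ge0 i : 0 <= `|x i - y| + `|x i - z| - `|(x i - y) + (x i - z)|.
  by rewrite subr_ge0 ler_normD.
have le0 : \sum_(i < k)
    (`|x i - y| + `|x i - z| - `|(x i - y) + (x i - z)|) <= 0.
  rewrite (eq_bigr _ (fun i _ => term i)) sumrB big_split /= -mulr_sumr.
  move: (qy m) (qz m); rewrite /quantile_objective.
  lra.
have sum0 : \sum_(i < k)
    (`|x i - y| + `|x i - z| - `|(x i - y) + (x i - z)|) = 0.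
  by apply/le_anti; rewrite le0 sumr_ge0.
move=> i; apply/esym/subr0_eq.
exact: (psumr_eq0P (fun i _ => ge0 i) sum0).
Qed.

(** Each data point contributes [u (z - y)] plus or minus [`|z - y|] to the
    difference of the two objective values, and these contributions sum to
    zero. *)
Lemma quantiles_balance (R : realType) (X : normedModType R) (k : nat)
    (x : 'I_k -> X) (u : {linear X -> R^o}) (y z : X) :
  quantile_objective x u y = quantile_objective x u z ->
  (forall i, `|x i - y| - `|x i - z| =
     if `|x i - z| < `|x i - y| then `|z - y| else - `|z - y|) ->
  k%:R * u (z - y) =
    (k%:R - 2 * #|[pred i | `|x i - z| < `|x i - y|]|%:R) * `|z - y|.
Proof.
move=> /eqP; rewrite -subr_eq0 /quantile_objective -sumrB => /eqP Q0 sides.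
pose D : R := `|z - y|.
have term i : (`|x i - y| + u (x i - y)) - (`|x i - z| + u (x i - z)) =
    ((if `|x i - z| < `|x i - y| then 2 * D else 0) + (u (z - y) - D) : R).
  have uE : u (x i - y) - u (x i - z) = u (z - y).
    by rewrite -linearB opprB addrC subrKA.
  move: (sides i) uE; rewrite -/D; case: ifP => _;
    set p : R := u (x i - y); set q : R := u (x i - z);
    set r : R := u (z - y); lra.
set A := #|_|.
have count : \sum_(i < k) (if `|x i - z| < `|x i - y| then 2 * D else 0) =
    A%:R * (2 * D) by rewrite -big_mkcond sumr_const [RHS]mulr_natl.
move: Q0; rewrite (eq_bigr _ (fun i _ => term i)) big_split /= count.
rewrite sumr_const card_ord -[X in _ + X]mulr_natl -/D.
set r : R := u (z - y); lra.
Qed.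

(** * The quantile parameter on the line *)

(** On [W] the summand [v] of [u] vanishes. The summand [e] kills [ker P], so it
    is determined by its value at a unit vector of [W]; as [P] does not increase
    norms, this value must have modulus [opnorm e = 1]. *)
Lemma quantile_parameter_on_line (R : realType) (X : normedModType R)
    (u : {linear X -> R^o}) (W : set X) (alpha : R) (h : X) :
  quantile_parameter u W alpha -> W = range (fun t : R => t *: h) -> h != 0 ->
  `|u h| = `|2 * alpha - 1| * `|h|.
Proof.
move=> [P [e [v [s /= [[cP PP rP nP] [[ce eY] ne] [cv vW] [uE s1] ->]]]]] WE h0.
have nh : 0 < `|h| by rewrite normr_gt0.
have Wh : W h by rewrite WE; exists 1; rewrite ?scale1r.
have eP w : e w = e (P w).
  apply/eqP; rewrite -subr_eq0 -linearB; apply/eqP/eY.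
  by rewrite /= linearB -[P (P w)]/((P \o P) w) PP subrr.
have eh : `|e h| = `|h|.
  apply/le_anti/andP; split.
    by rewrite (le_trans (opnorm_ge _ _ _ e h ce)) // ne mul1r.
  rewrite -[leLHS]mul1r -ler_pdivlMr // -ne.
  apply: opnorm_le; first by rewrite divr_ge0.
  move=> w; have [t _ tE] : range (fun t : R => t *: h) (P w).
    by rewrite -WE -rP; exists w.
  have Pw : `|t| * `|h| <= `|w|.
    rewrite -normrZ tE; apply: le_trans (opnorm_ge _ _ _ P w cP) _.
    by rewrite nP mul1r.
  rewrite (eP w) -tE linearZ normrZ mulrAC ler_pdivlMr //.
  by rewrite -mulrA [_ * `|h|]mulrC mulrA mulrC ler_wpM2l.
rewrite uE (vW _ Wh) addr0 normrM eh; congr (`|_| * _); lra.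
Qed.

Theorem theorem4p9 (R : realType) (X : completeNormedModType R)
    (hX : strictly_convex X)
    (u : {linear X -> R^o}) (hu : continuous u) (hu1 : opnorm u < 1)
    (k : nat) (hk : (0 < k)%N) (x : 'I_k -> X)
    (hx : ~ on_straight_line x \/
      exists (p : X) (W : set X) (alpha : R),
        [/\ one_dimensional W, on_translate x p W, quantile_parameter u W alpha,
            0 < alpha < 1
          & ~ exists2 j : nat, (0 < j < k)%N & alpha = j%:R / k%:R]) :
  forall y z : X,
    geometric_quantile x u y -> geometric_quantile x u z -> y = z.
Proof.
move=> y z qy qz; apply/eqP; apply: contrapT => /negP yz.
pose d := z - y.
have d0 : d != 0 by rewrite subr_eq0 eq_sym.
have nd : 0 < `|d| by rewrite normr_gt0.
have abE i : (x i - y) - (x i - z) = d by rewrite opprB addrC subrKA.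
have ray i := ray_difference _ _ _ _
  (strictly_convex_ray _ _ _ _ hX (quantiles_norm_eq _ _ _ _ _ _ _ qy qz i)).
have {}ray i : (exists t, x i - y = t *: d) /\ `|x i - y| - `|x i - z| =
    if `|x i - z| < `|x i - y| then `|d| else - `|d|.
  by rewrite -(abE i); apply: ray; rewrite -subr_eq0 abE.
case: hx => [nline|].
  apply: nline; exists y, (range (fun t : R => t *: d)); split.
    by exists d => //; apply/eqP.
  by move=> i; have [[t ->] _] := ray i; exists t.
move=> [p [W [alpha [[d1 d10 WE] xW par _ notfrac]]]].
have Qyz : quantile_objective x u y = quantile_objective x u z.
  by apply/le_anti; rewrite (qy z) (qz y).
have := quantiles_balance _ _ _ _ _ _ _ Qyz (fun i => proj2 (ray i)).
rewrite -/d; set A := #|_| => bal.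
have k0 : 0 < k%:R :> R by rewrite ltr0n.
have Ak : (A <= k)%N by rewrite -[k]card_ord max_card.
have ud : `|u d| < `|d|.
  apply: le_lt_trans (opnorm_ge _ _ _ u d hu) _.
  by rewrite gtr_pMl.
have balN : k%:R * `|u d| = `|k%:R - 2 * A%:R| * `|d|.
  by rewrite -[k%:R in LHS](gtr0_norm k0) -normrM bal normrM normr_id.
have A0 : (0 < A)%N.
  rewrite lt0n; apply/eqP => A0; move: balN; rewrite A0 mulr0 subr0 (gtr0_norm k0).
  by move=> e; rewrite (mulfI (lt0r_neq0 k0) e) ltxx in ud.
have ltAk : (A < k)%N.
  rewrite ltn_neqAle Ak andbT; apply/eqP => Ae; move: balN; rewrite Ae.
  have -> : k%:R - 2 * k%:R = - k%:R :> R by ring.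
  rewrite normrN (gtr0_norm k0).
  by move=> e; rewrite (mulfI (lt0r_neq0 k0) e) ltxx in ud.
(* The difference of two data points on opposite sides of the segment is a
   nonzero multiple of [d], and it also lies in [W]. *)
have /card_gt0P [j] := A0; rewrite inE => jA.
have [i iA] : exists i, ~~ (`|x i - z| < `|x i - y|).
  apply/existsP; rewrite -negb_forall; apply/negP => /forallP H.
  suff : A = k by move=> Ae; rewrite Ae ltnn in ltAk.
  by rewrite -[RHS]card_ord; apply: eq_card => i; rewrite !inE H.
have [[ti xi] si] := ray i; have [[tj xj] sj] := ray j.
have tij : ti - tj != 0.
  rewrite subr_eq0; apply/eqP => tE.
  have xij : x i = x j by apply: (addIr (- y)); rewrite xi xj tE.
  by rewrite xij jA in iA.
have [c dc] : exists c : R, d = c *: d1.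
  have := xW i; have := xW j; rewrite WE => -[sj' _ ej] [si' _ ei].
  exists ((ti - tj)^-1 * (si' - sj')).
  have E : (si' - sj') *: d1 = (ti - tj) *: d.
    by rewrite !scalerBl ei ej -xi -xj !opprB !subrKA.
  by rewrite -scalerA E scalerA mulVf // scale1r.
have c0 : c != 0.
  by apply: contraNneq d0 => c0; rewrite dc c0 scale0r.
have Wd : W = range (fun t : R => t *: d).
  rewrite WE; apply/seteqP; split=> w [t _ <-] /=.
    by exists (t / c) => //; rewrite dc scalerA mulfVK.
  by exists (t * c) => //; rewrite dc scalerA.
have uda := quantile_parameter_on_line _ _ _ _ _ _ par Wd d0.
have abs : `|k%:R * (2 * alpha - 1)| = `|k%:R - 2 * A%:R|.
  apply: (mulIf (lt0r_neq0 nd)).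
  by rewrite -balN uda normrM (gtr0_norm k0) mulrA.
apply: notfrac.
have frac j' : alpha * k%:R = j'%:R -> alpha = j'%:R / k%:R.
  by move=> <-; rewrite mulfK // gt_eqF.
(* The sign reflects the two possible orientations of [e]. *)
have [E|E] : k%:R * (2 * alpha - 1) = k%:R - 2 * A%:R \/
             k%:R * (2 * alpha - 1) = - (k%:R - 2 * A%:R).
  by move/eqP: abs; rewrite eqr_norm2 => /orP[/eqP|/eqP]; [left|right].
- exists (k - A)%N; first by rewrite subn_gt0 ltAk ltn_subrL A0.
  by apply: frac; rewrite natrB //; lra.
- exists A; first by rewrite A0.
  by apply: frac; lra.
Qed.
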